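(* For each $\alpha$ with $3\le\alpha<\omega$ there are continuum many varieties between $RCPEA_\alpha$ and $RPEA_\alpha$, i.e., continuum many varieties $V$ of polyadic-type algebras of dimension $\alpha$ with $RPEA_\alpha\subseteq V\subseteq RCPEA_\alpha$.
   Context: A polyadic-type algebra (of dimension $\alpha$) is an algebra $\langle A,+,-,c_i,d_{ij},p_{ij}\rangle_{i,j<\alpha}$ with $+$ binary, $-,c_i,p_{ij}$ unary, $d_{ij}$ constants. Its cylindric reduct is $\langle A,+,-,c_i,d_{ij}\rangle_{i,j<\alpha}$. A variety is a class of algebras consisting of all algebras (of the given similarity type) in which some given set of equations is true. A polyadic equality set algebra of dimension $\alpha$ with base set $U$ is an algebra $\langle A,+,-,C^U_i,D^U_{ij},P_{ij}\rangle_{i,j<\alpha}$, where $A$ is a set of subsets of $U^\alpha$ containing the $D^U_{ij}$ and closed under the operations: $+$ is union, $-$ is complement with respect to $U^\alpha$, $C^U_i(X)=\{u\in U^\alpha : \text{there is } u'\in X \text{ with } u_j=u'_j \text{ for all } j\neq i\}$, $D^U_{ij}=\{u\in U^\alpha : u_i=u_j\}$, and $P_{ij}(X)=\{u\in U^\alpha : \text{there is } u'\in X \text{ with } u_i=u'_j,\ u_j=u'_i,\ u_l=u'_l \text{ for all } l\notin\{i,j\}\}$; $Pse_\alpha$ is the class of these. A cylindric set algebra of dimension $\alpha$ is defined in the same way with the operations $P_{ij}$ omitted (and closure under $P_{ij}$ not required); $Cs_\alpha$ is the class of these. $RPEA_\alpha$ is the class of all polyadic-type algebras in which all equations true in $Pse_\alpha$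 are true. $RCPEA_\alpha$ is the class of all polyadic-type algebras in whose cylindric reduct all equations true in $Cs_\alpha$ are true and in which the following equations hold for all $i,j,k,l<\alpha$, where $\tau=[i,j]$ is the function on $\alpha$ interchanging $i$ and $j$ and fixing everything else, and $x\cdot y=-(-x+-y)$: (P1) $p_{ij}(x+y)=p_{ij}x+p_{ij}y$; (P2) $p_{ij}(-x)=-p_{ij}x$; (P3) $p_{ij}(c_kx)=c_{\tau(k)}p_{ij}x$; (P4) $p_{ij}d_{kl}=d_{\tau(k)\tau(l)}$; (P5) $p_{ij}p_{kl}x=p_{\tau(k)\tau(l)}p_{ij}x$; (P6) $p_{ij}p_{ij}x=x$; (P7) $p_{ii}x=x$; (P8) $p_{ij}(x\cdot d_{ij})=x\cdot d_{ij}$. *)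

(* Defs.v *)
From mathcomp Require Import all_boot fingroup perm.
From mathcomp Require Import boolp classical_sets.

Set Implicit Arguments.
Unset Strict Implicit.
Unset Printing Implicit Defensive.

Local Open Scope classical_set_scope.

Record cyl_algebra (n : nat) : Type := CylAlgebra {
  cyl_sort :> Type;
  cyl_add : cyl_sort -> cyl_sort -> cyl_sort;
  cyl_opp : cyl_sort -> cyl_sort;
  cyl_c : 'I_n -> cyl_sort -> cyl_sort;
  cyl_d : 'I_n -> 'I_n -> cyl_sort }.

Record pol_algebra (n : nat) : Type := PolAlgebra {
  pol_sort :> Type;
  pol_add : pol_sort -> pol_sort -> pol_sort;
  pol_opp : pol_sort -> pol_sort;
  pol_c : 'I_n -> pol_sort -> pol_sort;
  pol_d : 'I_n -> 'I_n -> pol_sort;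
  pol_p : 'I_n -> 'I_n -> pol_sort -> pol_sort }.

Definition cyl_reduct (n : nat) (B : pol_algebra n) : cyl_algebra n :=
  CylAlgebra (@pol_add n B) (@pol_opp n B) (@pol_c n B) (@pol_d n B).

Inductive cyl_term (n : nat) : Type :=
| CVar of nat
| CAdd of cyl_term n & cyl_term n
| COpp of cyl_term n
| CC of 'I_n & cyl_term n
| CD of 'I_n & 'I_n.

Inductive pol_term (n : nat) : Type :=
| PVar of nat
| PAdd of pol_term n & pol_term n
| POpp of pol_term n
| PC of 'I_n & pol_term n
| PD of 'I_n & 'I_n
| PP of 'I_n & 'I_n & pol_term n.

Fixpoint cyl_eval (n : nat) (B : cyl_algebra n) (v : nat -> B)
    (t : cyl_term n) : B :=
  match t with
  | CVar k => v k
  | CAdd t1 t2 => cyl_add (cyl_eval v t1) (cyl_eval v t2)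
  | COpp t1 => cyl_opp (cyl_eval v t1)
  | CC i t1 => cyl_c i (cyl_eval v t1)
  | CD i j => cyl_d B i j
  end.

Fixpoint pol_eval (n : nat) (B : pol_algebra n) (v : nat -> B)
    (t : pol_term n) : B :=
  match t with
  | PVar k => v k
  | PAdd t1 t2 => pol_add (pol_eval v t1) (pol_eval v t2)
  | POpp t1 => pol_opp (pol_eval v t1)
  | PC i t1 => pol_c i (pol_eval v t1)
  | PD i j => pol_d B i j
  | PP i j t1 => pol_p i j (pol_eval v t1)
  end.

(* An equation is a pair of terms. *)
Definition cyl_true (n : nat) (B : cyl_algebra n)
    (e : cyl_term n * cyl_term n) : Prop :=
  forall v : nat -> B, cyl_eval v e.1 = cyl_eval v e.2.

Definition pol_true (n : nat) (B : pol_algebra n)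
    (e : pol_term n * pol_term n) : Prop :=
  forall v : nat -> B, pol_eval v e.1 = pol_eval v e.2.

(* Classes of algebras are plain predicates instead of [set (pol_algebra n)]:
   carriers such as [set ('I_n -> U)] force [pol_algebra n] into a universe
   above the one [set] ranges over.  By extensionality, classes with the same
   members are equal. *)
Definition variety (n : nat) (V : pol_algebra n -> Prop) : Prop :=
  exists E : set (pol_term n * pol_term n),
    V = (fun B => forall e, E e -> pol_true B e).

Section SetOperations.
Variables (n : nat) (U : Type).
Implicit Types (X Y : set ('I_n -> U)) (i j : 'I_n).

Definition cylindrification i X : set ('I_n -> U) :=
  [set u | exists2 u', X u' & forall j, j != i -> u j = u' j].

Definition diagonal_set i j : set ('I_n -> U) := [set u | u i = u j].

Definition transposition i j X : set ('I_n -> U) :=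
  [set u | exists2 u', X u' &
     [/\ u i = u' j, u j = u' i &
         forall l, l != i -> l != j -> u l = u' l]].

Record cyl_closed (A : set (set ('I_n -> U))) : Prop := CylClosed {
  closed_add : forall X Y, A X -> A Y -> A (X `|` Y);
  closed_opp : forall X, A X -> A (~` X);
  closed_c : forall i X, A X -> A (cylindrification i X);
  closed_d : forall i j, A (diagonal_set i j) }.

Record pol_closed (A : set (set ('I_n -> U))) : Prop := PolClosed {
  pol_closed_cyl :> cyl_closed A;
  closed_p : forall i j X, A X -> A (transposition i j X) }.

Definition cyl_set_algebra (A : set (set ('I_n -> U))) (hA : cyl_closed A) :
    cyl_algebra n :=
  @CylAlgebra n (sig A)
    (fun x y => exist A (sval x `|` sval y)
                  (closed_add hA (svalP x) (svalP y)))
    (fun x => exist A (~` sval x) (closed_opp hA (svalP x)))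
    (fun i x => exist A (cylindrification i (sval x))
                  (closed_c hA i (svalP x)))
    (fun i j => exist A (diagonal_set i j) (closed_d hA i j)).

Definition pol_set_algebra (A : set (set ('I_n -> U))) (hA : pol_closed A) :
    pol_algebra n :=
  @PolAlgebra n (sig A)
    (fun x y => exist A (sval x `|` sval y)
                  (closed_add hA (svalP x) (svalP y)))
    (fun x => exist A (~` sval x) (closed_opp hA (svalP x)))
    (fun i x => exist A (cylindrification i (sval x))
                  (closed_c hA i (svalP x)))
    (fun i j => exist A (diagonal_set i j) (closed_d hA i j))
    (fun i j x => exist A (transposition i j (sval x))
                    (closed_p hA i j (svalP x))).

End SetOperations.

Definition Cs (n : nat) (B : cyl_algebra n) : Prop :=
  exists (U : Type) (A : set (set ('I_n -> U))) (hA : cyl_closed A),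
    B = cyl_set_algebra hA.

Definition Pse (n : nat) (B : pol_algebra n) : Prop :=
  exists (U : Type) (A : set (set ('I_n -> U))) (hA : pol_closed A),
    B = pol_set_algebra hA.

Definition RPEA (n : nat) (B : pol_algebra n) : Prop :=
  forall e, (forall S, Pse S -> pol_true S e) -> pol_true B e.

Definition pol_mul (n : nat) (B : pol_algebra n) (x y : B) : B :=
  pol_opp (pol_add (pol_opp x) (pol_opp y)).

Record polyadic_axioms (n : nat) (B : pol_algebra n) : Prop := PolyadicAxioms {
  P1 : forall (i j : 'I_n) (x y : B),
    pol_p i j (pol_add x y) = pol_add (pol_p i j x) (pol_p i j y);
  P2 : forall (i j : 'I_n) (x : B), pol_p i j (pol_opp x) = pol_opp (pol_p i j x);
  P3 : forall (i j k : 'I_n) (x : B),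
    pol_p i j (pol_c k x) = pol_c (tperm i j k) (pol_p i j x);
  P4 : forall i j k l : 'I_n,
    pol_p i j (pol_d B k l) = pol_d B (tperm i j k) (tperm i j l);
  P5 : forall (i j k l : 'I_n) (x : B),
    pol_p i j (pol_p k l x) = pol_p (tperm i j k) (tperm i j l) (pol_p i j x);
  P6 : forall (i j : 'I_n) (x : B), pol_p i j (pol_p i j x) = x;
  P7 : forall (i : 'I_n) (x : B), pol_p i i x = x;
  P8 : forall (i j : 'I_n) (x : B),
    pol_p i j (pol_mul x (pol_d B i j)) = pol_mul x (pol_d B i j) }.

Definition RCPEA (n : nat) (B : pol_algebra n) : Prop :=
  (forall e, (forall S, Cs S -> cyl_true S e) -> cyl_true (cyl_reduct B) e) /\
  polyadic_axioms B.

(* [P] has cardinality exactly 2^aleph_0: some [f] is a bijection from the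
   power set of [nat] onto [P].  Classes of algebras live in too large a
   universe for the equipotence [#=] of the cardinality library. *)
Definition continuum_many (T : Type) (P : T -> Prop) : Prop :=
  exists f : set nat -> T,
    (forall s t, f s = f t -> s = t) /\ (forall x, P x <-> exists s, f s = x).

(* Main.v *)
Require Import Defs.
From mathcomp Require Import all_boot all_algebra fingroup perm.
From mathcomp Require Import boolp classical_sets functions cardinality.
From mathcomp Require Import ring.

(** There are only continuum many sets of equations, so the point is to find
    many varieties in the interval. It suffices to have, for every odd prime
    [p], an algebra A_p in RCPEA and an equation e_p that is true in Pse and in
    every A_q with [q <> p] but fails in A_p: the varieties defined by the
    equations common to Pse and to the A_p with [p] in a given set are then
    pairwise distinct, and the Cantor-Bernstein theorem turns the two bounds
    into a bijection ([continuum_many_varieties]).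

    The algebra A_p ([pentagon_algebra]). Its base consists of [p] disjoint
    pentagons, numbered cyclically, and of a two-element set for every
    coordinate [k]. A flag is a tuple whose coordinates 0 and 1 form a
    directed edge of a pentagon and whose coordinate [k >= 2] lies in the
    [k]-th two-element set. The group of motions (cyclic shift of the pentagons,
    one dihedral symmetry applied to all of them, exchange of the elements in
    some of the two-element sets) is transitive on the flags; a motion is odd
    when the number of exchanged sets with [k >= 2], plus one for a reflection,
    is odd. Every
    single coordinate of a flag can be moved by an odd motion that fixes all the
    other coordinates, so the two orbits of the even motions on the flags
    ([flag_part]) have the same cylindrifications. Hence cylindric algebra does
    not see which of the two halves is which, and P1-P8 survive when the
    transposition [p_ij], [i <> j], on the flags and their coordinate
    permutations is followed by an odd motion ([twisted_polyadic_axioms]). The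
    cylindric reduct is still a set algebra, so A_p is in RCPEA. Reversing an
    edge is odd: the genuine transposition of the coordinates 0 and 1 exchanges
    the two halves, while the twisted [p_01] fixes both.

    The equation e_p ([separating_eq]). It says that the configuration just
    found cannot occur. If the two halves are symmetric in the coordinates 0
    and 1, then, the other coordinates being fixed, they are two disjoint
    perfect matchings that together form the edges of pentagons; but a pentagon
    has an odd number of vertices ([pentagonal_no_matchings]). That the edges
    are those of pentagons is expressible with three variables ([pentagonal]).
    The prime enters through one more requirement: there is a fixed-point-free
    function, invariant under the motions since it is an element of the algebra,
    whose [p]-th power is contained in the identity. In A_p the cyclic shift of
    the pentagons is one. In A_q every candidate acts on its domain as a power
    of the shift, of order [q], or as the exchange in a two-element set, of
    order 2 ([no_invariant_rotation]). *)

Set Implicit Arguments.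
Unset Strict Implicit.
Unset Printing Implicit Defensive.

Local Open Scope classical_set_scope.

(** * Set algebras *)

Definition upd n U (u : 'I_n -> U) i x : 'I_n -> U :=
  fun k => if k == i then x else u k.

Lemma cylindrificationP n U i (X : set ('I_n -> U)) u :
  cylindrification i X u <-> exists x, X (upd u i x).
Proof.
split=> [[u' Xu' eqn]|[x Xx]].
  exists (u' i); suff -> : upd u i (u' i) = u' by [].
  by apply: funext => k; rewrite /upd; case: eqVneq => [->|/eqn].
by exists (upd u i x) => // j /negPf; rewrite /upd => ->.
Qed.

Lemma transpositionE n U i j (X : set ('I_n -> U)) :
  transposition i j X = [set u : 'I_n -> U | X (u \o tperm i j)].
Proof.
apply/seteqP; split=> u /=.
  case=> u' Xu' [ui uj ul]; suff -> : u \o tperm i j = u' by [].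
  by apply: funext => k /=; case: tpermP => [->|->|/eqP ki /eqP kj] //; apply: ul.
move=> Xu; exists (u \o tperm i j) => //; split=> [||l li lj] /=.
- by rewrite tpermR.
- by rewrite tpermL.
- by rewrite tpermD // eq_sym.
Qed.

Definition expansion n U (A : set (set ('I_n -> U))) (hA : cyl_closed A)
    (p : 'I_n -> 'I_n -> sig A -> sig A) : pol_algebra n :=
  let C := cyl_set_algebra hA in
  @PolAlgebra n C (@cyl_add n C) (@cyl_opp n C) (@cyl_c n C) (@cyl_d n C) p.

(** * Twisting the transpositions of a set algebra *)

Record signed_action (U : Type) := SignedAction {
  group_elt :> Type;
  act : group_elt -> U -> U;
  gmul : group_elt -> group_elt -> group_elt;
  ginv : group_elt -> group_elt;
  sign : group_elt -> bool;
  act_mul : forall g h x, act (gmul g h) x = act g (act h x);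
  actK : forall g x, act (ginv g) (act g x) = x;
  actVK : forall g x, act g (act (ginv g) x) = x;
  sign_mul : forall g h, sign (gmul g h) = sign g (+) sign h;
  sign_inv : forall g, sign (ginv g) = sign g }.

Definition tact n U (G : signed_action U) (g : G) (t : 'I_n -> U) : 'I_n -> U :=
  fun k => act g (t k).

(** The data for twisting the transpositions on the tuples in [T]. Elements of
    [G] are called motions, odd if [sign] holds and even otherwise. [twist_flip]
    is the heart: an odd motion can hide in any single coordinate, which is why
    no cylindrification distinguishes the two halves of an orbit in [T]. *)
Record twisting n U (G : signed_action U) (T : set ('I_n -> U)) (z : G) :
    Prop := Twisting {
    twist_act : forall (g : G) t, T (tact g t) <-> T t;
    twist_perm : forall (s : 'S_n) t, T t -> T (t \o s);
    twist_inj : forall t, T t -> injective t;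
    twist_flip : forall t k, T t -> exists g : G,
      sign g /\ forall l, l != k -> act g (t l) = t l;
    twist_central : forall (g : G) x, act z (act g x) = act g (act z x);
    twist_invol : forall x, act z (act z x) = x }.

Section Twist.
Variables (n : nat) (U : Type) (G : signed_action U).
Variables (T : set ('I_n -> U)) (z : G).
Implicit Types (g : G) (t : 'I_n -> U) (X : set ('I_n -> U)) (i j k : 'I_n).

(** Sets that are invariant under all motions outside [T], but only under the
    even ones inside: on [T] an admissible set may contain one half of an orbit
    without the other. *)
Definition admissible X :=
  forall g t, X t -> (T t -> sign g = false) -> X (tact g t).

Definition twisted_swap i j t : 'I_n -> U :=
  if `[< T t >] && (i != j) then tact z (t \o tperm i j) else t \o tperm i j.

Definition twisted_transposition i j X : set ('I_n -> U) :=
  [set t | X (twisted_swap i j t)].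

Hypothesis tw : twisting T z.

Let tactK g t : tact (ginv g) (tact g t) = t.
Proof. by apply: funext => k; rewrite /tact actK. Qed.

Let tactVK g t : tact g (tact (ginv g) t) = t.
Proof. by apply: funext => k; rewrite /tact actVK. Qed.

Let tact_upd g t k x : tact g (upd t k x) = upd (tact g t) k (act g x).
Proof. by apply: funext => l; rewrite /tact /upd; case: ifP. Qed.

Let T_perm (s : 'S_n) t : T (t \o s) <-> T t.
Proof.
split; last exact: (twist_perm tw).
move/(twist_perm tw s^-1); suff -> : (t \o s) \o (s^-1)%g = t by [].
by apply: funext => k /=; rewrite permKV.
Qed.

Lemma T_twisted_swap i j t : T (twisted_swap i j t) <-> T t.
Proof.
rewrite /twisted_swap; case: ifP => _; last exact: T_perm.
by rewrite (twist_act tw); exact: T_perm.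
Qed.

Lemma twisted_swap_tact i j g t :
  twisted_swap i j (tact g t) = tact g (twisted_swap i j t).
Proof.
rewrite /twisted_swap (asbool_equiv_eq (twist_act tw g t)); case: ifP => _ //.
by apply: funext => k; rewrite /tact /= (twist_central tw).
Qed.

Lemma admissibleN X : admissible X -> admissible (~` X).
Proof.
move=> aX g t nX sg Xg; apply: nX; rewrite -(tactK g t); apply: aX => //.
by rewrite (twist_act tw) sign_inv.
Qed.

Lemma admissibleU X Y : admissible X -> admissible Y -> admissible (X `|` Y).
Proof.
by move=> aX aY g t [Xt|Yt] sg; [left; apply: aX|right; apply: aY].
Qed.

Lemma admissible_diagonal i j : admissible (@diagonal_set n U i j).
Proof. by move=> g t tij _; rewrite /diagonal_set /tact /= tij. Qed.

(** The halves of an orbit in [T] become indistinguishable after one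
    cylindrification: when an odd motion would leave [X], composing it with an
    odd motion that only affects coordinate [k] makes it even. *)
Lemma cylindrification_invariant k X g t : admissible X ->
  cylindrification k X t -> cylindrification k X (tact g t).
Proof.
move=> aX /cylindrificationP[x Xx]; apply/cylindrificationP.
have [bad|good] := pselect (T (upd t k x) /\ sign g); last first.
  exists (act g x); rewrite -tact_upd; apply: aX => // Tx.
  by case: (boolP (sign g)) good => // sg []; split.
have [Tx sg] := bad; have [f [sf fE]] := twist_flip tw k Tx.
exists (act (gmul g f) x).
suff -> : upd (tact g t) k (act (gmul g f) x) = tact (gmul g f) (upd t k x).
  by apply: aX => // _; rewrite sign_mul sg sf.
apply: funext => l; rewrite /tact /upd; case: eqVneq => [//|lk].
by rewrite act_mul; have := fE _ lk; rewrite /upd (negPf lk) => ->.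
Qed.

Lemma cylindrification_invariantE k X g t : admissible X ->
  cylindrification k X (tact g t) <-> cylindrification k X t.
Proof.
move=> aX; split; last exact: cylindrification_invariant.
by move/(cylindrification_invariant (ginv g) aX); rewrite tactK.
Qed.

Lemma admissible_cylindrification k X :
  admissible X -> admissible (cylindrification k X).
Proof. by move=> aX g t /(cylindrification_invariant g aX). Qed.

Lemma admissible_twisted i j X :
  admissible X -> admissible (twisted_transposition i j X).
Proof.
move=> aX g t Xt sg; rewrite /twisted_transposition /= twisted_swap_tact.
by apply: aX => // /T_twisted_swap.
Qed.

(** By [cylindrification_invariant] the twist is invisible on a cylindrified
    set, and replacing the members of [X] by their images under motions does not
    change [cylindrification k X]. So both sides equal the genuine transposition
    of that set. *)
Lemma twisted_cylindrification i j k X : admissible X ->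
  twisted_transposition i j (cylindrification k X) =
  cylindrification (tperm i j k) (twisted_transposition i j X).
Proof.
move=> aX; set Y := twisted_transposition i j X.
have aY : admissible Y by exact: admissible_twisted.
have swapE t : cylindrification k X (twisted_swap i j t) <->
               cylindrification k X (t \o tperm i j).
  by rewrite /twisted_swap; case: ifP => // _; apply: cylindrification_invariantE.
have sub Z l t : Z t -> cylindrification l Z t by exists t.
apply/seteqP; split=> t.
  move/swapE/cylindrificationP=> [x Xx]; set s := upd _ _ _ in Xx.
  (* Either t' or its image under the odd motion z is taken to s in X. *)
  pose t' := s \o tperm i j.
  suff : cylindrification (tperm i j k) Y t'.
    case/cylindrificationP=> y Yy; apply/cylindrificationP; exists y.
    suff <- : upd t' (tperm i j k) y = upd t (tperm i j k) y by [].
    apply: funext => l; rewrite /upd; case: eqVneq => // lk.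
    rewrite /t' /s /= /upd; case: eqVneq => [e|_]; last by rewrite /= tpermK.
    by rewrite -e tpermK eqxx in lk.
  have t'E : t' \o tperm i j = s by apply: funext => l; rewrite /t' /= tpermK.
  case: (boolP (`[< T t' >] && (i != j))) => c.
    have c' : `[< T (tact z t') >] && (i != j).
      by rewrite (asbool_equiv_eq (twist_act tw z t')).
    rewrite -(cylindrification_invariantE _ z) //; apply: sub.
    rewrite /Y /twisted_transposition /= /twisted_swap c'.
    suff -> : tact z (tact z t' \o tperm i j) = s by [].
    by rewrite -t'E; apply: funext => l; rewrite /tact /= (twist_invol tw).
  by apply: sub; rewrite /Y /twisted_transposition /= /twisted_swap (negPf c) t'E.
case/cylindrificationP=> x Yx.
have /swapE/cylindrificationP[y Xy] :
    cylindrification k X (twisted_swap i j (upd t (tperm i j k) x)).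
  exact: sub.
apply/swapE/cylindrificationP; exists y.
suff <- : upd (upd t (tperm i j k) x \o tperm i j) k y = upd (t \o tperm i j) k y.
  by [].
apply: funext => l; rewrite /upd /=; case: eqVneq => // lk.
by rewrite (inj_eq perm_inj) (negPf lk).
Qed.

Lemma twisted_diagonal i j k l :
  twisted_transposition i j (@diagonal_set n U k l) =
  diagonal_set (tperm i j k) (tperm i j l).
Proof.
apply/seteqP; split=> t; rewrite /twisted_transposition /diagonal_set /=
  /twisted_swap; case: ifP => // _; rewrite /tact /=.
  by move/(congr1 (act (ginv z))); rewrite !actK.
by move->.
Qed.

(** Transpositions are odd and conjugation preserves parity, so [z] is applied
    equally often on both sides. This is where it matters that the twist depends
    on nothing but the parity of the permutation. *)
Lemma twisted_swap_conj i j k l t :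
  twisted_swap k l (twisted_swap i j t) =
  twisted_swap i j (twisted_swap (tperm i j k) (tperm i j l) t).
Proof.
have TE a b t' : `[< T (twisted_swap a b t') >] = `[< T t' >].
  by apply: asbool_equiv_eq; exact: T_twisted_swap.
have permE : (t \o tperm i j) \o tperm k l =
             (t \o tperm (tperm i j k) (tperm i j l)) \o tperm i j.
  by apply: funext => a /=; rewrite -tpermJ permJ.
have permE' a : t (tperm i j (tperm k l a)) =
    t (tperm (tperm i j k) (tperm i j l) (tperm i j a)).
  exact: (congr1 (fun f => f a) permE).
rewrite [LHS]/twisted_swap TE [RHS]/twisted_swap TE.
rewrite /twisted_swap (inj_eq perm_inj).
case: `[< T t >] => //=; case: (k == l); case: (i == j) => //=;
  by apply: funext => a; rewrite /tact /= permE'.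
Qed.

Lemma twisted_swapK i j t : twisted_swap i j (twisted_swap i j t) = t.
Proof.
have TE : `[< T (twisted_swap i j t) >] = `[< T t >].
  by apply: asbool_equiv_eq; exact: T_twisted_swap.
rewrite [LHS]/twisted_swap TE /twisted_swap.
case: (_ && _); apply: funext => a; rewrite /tact /=; last by rewrite tpermK.
by rewrite (twist_invol tw) tpermK.
Qed.

Lemma twisted_swap_id i t : twisted_swap i i t = t.
Proof.
rewrite /twisted_swap eqxx andbF tperm1.
by apply: funext => a /=; rewrite perm1.
Qed.

Lemma twisted_swap_fixed i j t : t i = t j -> twisted_swap i j t = t.
Proof.
move=> tij; rewrite /twisted_swap; case: ifP => [/andP[/asboolP Tt /eqP[]]|_].
  exact: (twist_inj tw Tt).
by apply: funext => k /=; case: tpermP => // ->.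
Qed.

Lemma twisted_polyadic_axioms (A : set (set ('I_n -> U))) (hA : cyl_closed A)
    (p : 'I_n -> 'I_n -> sig A -> sig A) :
  (forall X, A X -> admissible X) ->
  (forall i j x, sval (p i j x) = twisted_transposition i j (sval x)) ->
  polyadic_axioms (expansion hA p).
Proof.
move=> admA pE.
have sval_inj (x y : sig A) : sval x = sval y -> x = y.
  by case: x y => X hX [Y hY]; exact: eq_exist.
have pP i j (x : sig A) t : sval (p i j x) t = sval x (twisted_swap i j t).
  by rewrite pE.
split=> /=.
- by move=> i j x y; apply: sval_inj; rewrite /= !pE.
- by move=> i j x; apply: sval_inj; rewrite /= !pE.
- move=> i j k x; apply: sval_inj; rewrite /= !pE /=.
  by apply: twisted_cylindrification; exact: admA (svalP x).
- by move=> i j k l; apply: sval_inj; rewrite /= !pE twisted_diagonal.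
- move=> i j k l x; apply/sval_inj/funext => t.
  by rewrite !pP twisted_swap_conj.
- by move=> i j x; apply/sval_inj/funext => t; rewrite !pP twisted_swapK.
- by move=> i x; apply/sval_inj/funext => t; rewrite !pP twisted_swap_id.
- move=> i j x; apply/sval_inj; rewrite pE /=; set D := diagonal_set i j.
  have DE t : D (twisted_swap i j t) <-> D t.
    have -> : D (twisted_swap i j t) = twisted_transposition i j D t by [].
    by rewrite twisted_diagonal tpermL tpermR /diagonal_set /D /=; split.
  apply/seteqP; split=> t; rewrite /twisted_transposition /=.
    move=> H; have [Dt|nDt] := pselect (D t).
      by move: H; rewrite twisted_swap_fixed.
    by case: H; right=> /DE.
  move=> H; have [Dt|nDt] := pselect (D t).
    by rewrite twisted_swap_fixed.
  by case: H; right.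
Qed.

End Twist.

Definition trivial_action (U : Type) : signed_action U.
Proof.
by exists unit (fun _ => id) (fun _ _ => tt) id (fun _ => false).
Defined.

(** Without tuples to twist, [twisted_polyadic_axioms] says that genuine
    transpositions satisfy P1-P8. *)
Lemma twisting_set0 n U :
  twisting (set0 : set ('I_n -> U)) (tt : trivial_action U).
Proof. by split. Qed.

Lemma Pse_RCPEA n (B : pol_algebra n) : Pse B -> RCPEA B.
Proof.
case=> U [A [hA ->]]; split.
  by move=> e eE; apply: eE; exists U, A, hA.
apply: (twisted_polyadic_axioms (twisting_set0 n U) hA
  (p := @pol_p n (pol_set_algebra hA))).
  by move=> X _ g t Xt _; suff -> : tact g t = t by [].
move=> i j x /=; rewrite transpositionE; apply: funext => t.
rewrite /twisted_transposition /twisted_swap /=.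
by suff -> : `[< @set0 ('I_n -> U) t >] = false by []; apply/asboolP.
Qed.

(** * Equational consequences *)

Fixpoint pol_of_cyl n (t : cyl_term n) : pol_term n :=
  match t with
  | CVar k => PVar n k
  | CAdd t1 t2 => PAdd (pol_of_cyl t1) (pol_of_cyl t2)
  | COpp t1 => POpp (pol_of_cyl t1)
  | CC i t1 => PC i (pol_of_cyl t1)
  | CD i j => PD i j
  end.

Lemma eval_pol_of_cyl n (B : pol_algebra n) (v : nat -> B) t :
  pol_eval v (pol_of_cyl t) = @cyl_eval n (cyl_reduct B) v t.
Proof. by elim: t => //= [t1 -> t2 ->|t ->|i t ->]. Qed.

Definition models n (K : pol_algebra n -> Prop) (B : pol_algebra n) : Prop :=
  forall e, (forall C, K C -> pol_true C e) -> pol_true B e.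

(** P1-P8 and the laws of cylindric set algebras are equations, hence inherited
    by everything that satisfies the equations common to a part of RCPEA. *)
Lemma models_RCPEA n (K : pol_algebra n -> Prop) B :
  (forall C, K C -> RCPEA C) -> models K B -> RCPEA B.
Proof.
move=> KR mB; split=> [e eE v|].
  rewrite -!eval_pol_of_cyl; apply: (mB (pol_of_cyl e.1, pol_of_cyl e.2)).
  by move=> C /KR[CE _] w; rewrite /= !eval_pol_of_cyl; exact: CE.
have ax e (v : nat -> B) : (forall (C : pol_algebra n) (w : nat -> C),
    polyadic_axioms C ->
    pol_eval w e.1 = pol_eval w e.2) -> pol_eval v e.1 = pol_eval v e.2.
  by move=> eE; apply: mB => C /KR[_ aC] w; exact: eE.
pose val2 (x y : B) k := if k is 0 then x else y.
pose X := PVar n 0; pose Y := PVar n 1.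
split.
- move=> i j x y.
  apply: (ax (PP i j (PAdd X Y), PAdd (PP i j X) (PP i j Y)) (val2 x y)).
  by move=> C w aC; apply: P1.
- move=> i j x; apply: (ax (PP i j (POpp X), POpp (PP i j X)) (val2 x x)).
  by move=> C w aC; apply: P2.
- move=> i j k x.
  apply: (ax (PP i j (PC k X), PC (tperm i j k) (PP i j X)) (val2 x x)).
  by move=> C w aC; apply: P3.
- move=> i j k l.
  apply: (ax (PP i j (PD k l), PD (tperm i j k) (tperm i j l))
    (fun=> pol_d B i j)).
  by move=> C w aC; apply: P4.
- move=> i j k l x.
  apply: (ax (PP i j (PP k l X), PP (tperm i j k) (tperm i j l) (PP i j X))
    (val2 x x)).
  by move=> C w aC; apply: P5.
- move=> i j x; apply: (ax (PP i j (PP i j X), X) (val2 x x)).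
  by move=> C w aC; apply: P6.
- move=> i x; apply: (ax (PP i i X, X) (val2 x x)).
  by move=> C w aC; apply: P7.
- move=> i j x.
  pose XD := POpp (PAdd (POpp X) (POpp (PD i j))).
  apply: (ax (PP i j XD, XD) (val2 x x)).
  by move=> C w aC; apply: P8.
Qed.

(** * Counting varieties *)

Fixpoint tree_of_term n (t : pol_term n) : GenTree.tree nat :=
  match t with
  | PVar k => GenTree.Leaf k
  | PAdd t1 t2 => GenTree.Node 0 [:: tree_of_term t1; tree_of_term t2]
  | POpp t1 => GenTree.Node 1 [:: tree_of_term t1]
  | PC i t1 => GenTree.Node 2 [:: GenTree.Leaf (i : nat); tree_of_term t1]
  | PD i j => GenTree.Node 3 [:: GenTree.Leaf (i : nat); GenTree.Leaf (j : nat)]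
  | PP i j t1 => GenTree.Node 4
      [:: GenTree.Leaf (i : nat); GenTree.Leaf (j : nat); tree_of_term t1]
  end.

Lemma tree_of_term_inj n : injective (@tree_of_term n).
Proof.
elim=> [k|t1 IH1 t2 IH2|t1 IH1|i t1 IH1|i j|i j t1 IH1]
  [k'|s1 s2|s1|i' s1|i' j'|i' j' s1] //=.
- by case=> ->.
- by case=> /IH1-> /IH2->.
- by case=> /IH1->.
- by case=> /val_inj-> /IH1->.
- by case=> /val_inj-> /val_inj->.
- by case=> /val_inj-> /val_inj-> /IH1->.
Qed.

Definition eq_code n (e : pol_term n * pol_term n) : nat :=
  pickle (tree_of_term e.1, tree_of_term e.2).

Lemma eq_code_inj n : injective (@eq_code n).
Proof.
move=> [s t] [s' t'] /(pcan_inj pickleK)[].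
by move=> /tree_of_term_inj-> /tree_of_term_inj->.
Qed.

Definition theory n (V : pol_algebra n -> Prop) : set nat :=
  [set k | exists e, eq_code e = k /\ forall B, V B -> pol_true B e].

Definition class_of_theory n (s : set nat) (B : pol_algebra n) : Prop :=
  forall e, s (eq_code e) -> pol_true B e.

Lemma theoryK n (V : pol_algebra n -> Prop) :
  variety V -> class_of_theory (theory V) = V.
Proof.
case=> E VE; apply: funext => B; apply: propext; split=> [sB|VB e [e' []]].
  rewrite VE => e Ee; apply: sB; exists e; split=> // C.
  by rewrite VE; apply.
by move/eq_code_inj=> -> /(_ _ VB).
Qed.

(** Varieties are handled through the sets of codes of their equations, because
    [Cantor_Bernstein] applies to [set nat] but not to types of classes of
    algebras, whose universe is too large. *)
Lemma continuum_many_varieties n (P : (pol_algebra n -> Prop) -> Prop)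
    (W : set nat -> (pol_algebra n -> Prop)) :
  (forall V, P V -> variety V) -> (forall S, P (W S)) ->
  (forall S S', W S = W S' -> S = S') -> continuum_many P.
Proof.
move=> Pvar PW Winj.
pose D : set (set nat) := [set s | exists V, P V /\ theory V = s].
pose j S := theory (W S).
have [b [bD binj bsurj]] : exists b, set_bij [set: set nat] D b.
  apply/card_set_bijP/Cantor_Bernstein; last exact/subset_card_le.
  have jinj : {in [set: set nat] &, injective j}.
    move=> S S' _ _ /(congr1 (@class_of_theory n)).
    by rewrite !theoryK; [exact: Winj|exact: Pvar..].
  have /card_esym/card_eqPle[jT _] := inj_card_eq jinj.
  apply: card_le_trans jT _.
  by apply: subset_card_le => _ [S _ <-]; exists (W S).
have bK S : theory (@class_of_theory n (b S)) = b S.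
  by have [V [PV <-]] := bD S I; rewrite theoryK //; exact: Pvar.
exists (fun S => @class_of_theory n (b S)); split=> [S S' e|V]; last split.
- by apply: binj; rewrite ?inE // -bK e bK.
- move=> PV; have [|S _ bS] := bsurj (theory V); first by exists V.
  by exists S; rewrite bS theoryK //; exact: Pvar.
- case=> S <-; have [V' [PV' <-]] := bD S I.
  by rewrite theoryK //; exact: Pvar.
Qed.

(** * The separating equations *)

(** [h] represents the cylindric operations of [B] by the genuine ones on sets
    of tuples; the operations [pol_p] are left free, so that genuine and twisted
    set algebras are covered alike. *)
Record realizes n (B : pol_algebra n) U (h : B -> set ('I_n -> U)) : Prop :=
  Realizes {
    real_inj : injective h;
    real_add : forall x y u, h (pol_add x y) u <-> h x u \/ h y u;
    real_opp : forall x u, h (pol_opp x) u <-> ~ h x u;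
    real_c : forall i x u, h (pol_c i x) u <-> exists w, h x (upd u i w);
    real_d : forall i j u, h (pol_d B i j) u <-> u i = u j }.

Lemma realizes_expansion n U (A : set (set ('I_n -> U))) (hA : cyl_closed A) p :
  realizes (fun x : expansion hA p => sval x).
Proof.
split=> //= [x y|i x u]; last exact: cylindrificationP.
by case: x y => X hX [Y hY]; exact: eq_exist.
Qed.

Section Terms.
Variable n : nat.
Implicit Types (t : pol_term n) (i j k : 'I_n).

Definition tand t1 t2 := POpp (PAdd (POpp t1) (POpp t2)).
Definition timp t1 t2 := PAdd (POpp t1) t2.
(** The usual definition of substitution: [tsub i j t] is [t] with its [i]-th
    argument replaced by the [j]-th one. *)
Definition tsub i j t := PC i (tand (PD i j) t).
Definition texists (L : seq 'I_n) t := foldr (@PC n) t L.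
Fixpoint tall i (L : seq (pol_term n)) :=
  if L is t :: L' then tand t (tall i L') else PD i i.

Variables (B : pol_algebra n) (U : Type) (h : B -> set ('I_n -> U)).
Hypothesis hB : realizes h.
Variable v : nat -> B.

Definition sat t u := h (pol_eval v t) u.

Lemma sat_add t1 t2 u : sat (PAdd t1 t2) u <-> sat t1 u \/ sat t2 u.
Proof. exact: real_add. Qed.

Lemma sat_opp t u : sat (POpp t) u <-> ~ sat t u.
Proof. exact: real_opp. Qed.

Lemma sat_c i t u : sat (PC i t) u <-> exists w, sat t (upd u i w).
Proof. exact: real_c. Qed.

Lemma sat_d i j u : sat (PD i j) u <-> u i = u j.
Proof. exact: real_d. Qed.

Lemma sat_and t1 t2 u : sat (tand t1 t2) u <-> sat t1 u /\ sat t2 u.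
Proof.
rewrite sat_opp sat_add !sat_opp; split; last by case=> ? ? [].
by move/not_orP=> [/contrapT ? /contrapT ?].
Qed.

Lemma sat_imp t1 t2 u : sat (timp t1 t2) u <-> (sat t1 u -> sat t2 u).
Proof.
rewrite sat_add sat_opp; split=> [[]//|tt']; have [/tt'|] := pselect (sat t1 u).
  by right.
by left.
Qed.

Lemma sat_sub i j t u : i != j -> sat (tsub i j t) u <-> sat t (upd u i (u j)).
Proof.
move=> ij; rewrite sat_c; split=> [[w]|tu].
  rewrite sat_and sat_d /upd eqxx eq_sym (negPf ij).
  by case=> ->.
by exists (u j); rewrite sat_and sat_d /upd eqxx eq_sym (negPf ij).
Qed.

Lemma sat_exists L t u :
  sat (texists L t) u <->
  exists2 u', (forall k, k \notin L -> u' k = u k) & sat t u'.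
Proof.
elim: L u => [|i L IH] u /=.
  split=> [tu|[u' uu' tu']]; first by exists u.
  by have -> : u = u' by apply: funext => k; rewrite uu'.
rewrite sat_c; split=> [[w /IH[u' uu' tu']]|[u' uu' tu']].
  exists u' => // k; rewrite inE negb_or => /andP[/negPf ki kL].
  by rewrite uu' // /upd ki.
exists (u' i); apply/IH; exists u' => // k kL; rewrite /upd.
by case: eqVneq => [->//|ki]; rewrite uu' // inE negb_or ki.
Qed.

Lemma sat_all i L u :
  sat (tall i L) u <-> foldr (fun t P => sat t u /\ P) True L.
Proof.
elim: L => [|t L IH] /=; first by rewrite sat_d.
by rewrite sat_and IH.
Qed.

End Terms.

Section Hypotheses.
Variable n : nat.
Notation N := n.+3.

Definition o0 : 'I_N := @Ordinal N 0 isT.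
Definition o1 : 'I_N := @Ordinal N 1 isT.
Definition o2 : 'I_N := @Ordinal N 2 isT.

(** A set is a binary relation between the coordinates 0 and 1 when it absorbs
    cylindrification along all the other coordinates. For a variable denoting
    such a relation [r], [tvar02] and [tvar12] denote [r x0 x2] and
    [r x1 x2]. *)
Definition upper : seq 'I_N := filter (fun k : 'I_N => 1 < k) (enum 'I_N).

Definition tvar k : pol_term N := PVar N k.
Definition tvar02 k := tsub o1 o2 (tvar k).
Definition tvar12 k := tsub o0 o1 (tsub o1 o2 (tvar k)).
Definition tbinary k := timp (texists upper (tvar k)) (tvar k).

Fixpoint tpow k m : pol_term N :=
  if m is m'.+1 then PC o2 (tand (tvar02 k) (tsub o0 o2 (tpow k m')))
  else PD o0 o1.

Definition tE := tvar 0.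
Definition tF := tvar 1.
Definition tS := tvar 2.
Definition tR (b : bool) := tvar (if b then 4 else 3).

Definition binary_terms := [:: tbinary 0; tbinary 1; tbinary 2].

Definition pentagon_terms :=
  [:: timp (tand tE (tvar02 0)) (PAdd (PD o1 o2) (tvar12 1));
      timp (tand tF (tvar02 1)) (PAdd (PD o1 o2) (tvar12 0));
      timp tE (POpp tF); timp tE (POpp (PD o0 o1));
      timp tF (PC o2 (tand (tvar02 1) (tvar12 0)))].

Definition rotation_terms m :=
  [:: timp (tand tS (tvar02 2)) (PD o1 o2);
      timp tS (POpp (PD o0 o1)); timp (tpow 2 m) (PD o0 o1)].

Definition splitting_terms b :=
  [:: timp (tR b) tE; timp (tR b) (POpp (tR (~~ b)));
      timp (tR b) (PC o0 (tR (~~ b))); timp (tR b) (PC o1 tS);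
      timp (PP o0 o1 (tR b)) (tR b)].

Definition hypothesis m : pol_term N :=
  tall o0 (binary_terms ++ pentagon_terms ++ rotation_terms m ++
           splitting_terms false ++ splitting_terms true).

(** In a set algebra, quantifying over all coordinates yields the empty or the
    full set, so an implication between closed conditions is an equation. This
    one reads: if some tuple lies in [tR false], then some tuple violates the
    hypotheses. *)
Definition separating_eq m : pol_term N * pol_term N :=
  (PAdd (texists (enum 'I_N) (POpp (hypothesis m))) (POpp (tR false)),
   PD o0 o0).

(** The edges [e] and the diagonals [f] of disjoint pentagons. By [fork_e],
    [fork_f] and [disj_ef] neither edges nor diagonals form triangles, which
    bounds all degrees by two, as three neighbours of a point would form a
    triangle of diagonals; [f_fe] excludes squares. Each law involves
    three points only, whereas bounding the degree directly takes four, one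
    variable too many when the dimension is 3. *)
Record pentagonal U (e f : U -> U -> Prop) : Prop := Pentagonal {
  fork_e : forall x y z, e x y -> e x z -> y = z \/ f y z;
  fork_f : forall x y z, f x y -> f x z -> y = z \/ e y z;
  disj_ef : forall x y, e x y -> ~ f x y;
  irr_e : forall x y, e x y -> x <> y;
  f_fe : forall x y, f x y -> exists z, f x z /\ e y z }.

Fixpoint rpow U (s : U -> U -> Prop) m x y : Prop :=
  if m is m'.+1 then exists z, s x z /\ rpow s m' z y else x = y.

Record rotation U m (s : U -> U -> Prop) : Prop := Rotation {
  fun_s : forall x y z, s x y -> s x z -> y = z;
  irr_s : forall x y, s x y -> x <> y;
  pow_s : forall x y, rpow s m x y -> x = y }.

(** [R false] and [R true] stand for two disjoint sets of edges depending on the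
    coordinates beyond 1, and [Q] for their images under [p_01]. *)
Record splitting U (e s : U -> U -> Prop) (R Q : bool -> set ('I_N -> U)) :
    Prop := Splitting {
    split_e : forall b u, R b u -> e (u o0) (u o1);
    split_disj : forall b u, R b u -> ~ R (~~ b) u;
    split_flip : forall b u, R b u -> exists x, R (~~ b) (upd u o0 x);
    split_s : forall b u, R b u -> exists y, s (u o0) y;
    split_swap : forall b u, Q b u -> R b u }.

Section Semantics.
Variables (B : pol_algebra N) (U : Type) (h : B -> set ('I_N -> U)).
Hypothesis hB : realizes h.
Variable v : nat -> B.

Definition binary_set (X : set ('I_N -> U)) (r : U -> U -> Prop) :=
  forall u, X u <-> r (u o0) (u o1).

Definition triple (x y z : U) : 'I_N -> U :=
  fun k => if k == o0 then x else if k == o1 then y else z.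

Lemma sat_binary k :
  (forall u, sat h v (tbinary k) u) <-> exists r, binary_set (h (v k)) r.
Proof.
split=> [kP|[r rP] u].
  exists (fun x y => h (v k) (triple x y y)) => u.
  have agree u1 u2 : u1 o0 = u2 o0 -> u1 o1 = u2 o1 ->
      h (v k) u1 -> h (v k) u2.
    move=> e0 e1 ku1; move: (kP u2); rewrite (sat_imp hB); apply.
    apply/(sat_exists hB); exists u1 => // -[[|[|l]] lt_l].
    - by rewrite (_ : Ordinal lt_l = o0) //; exact: val_inj.
    - by rewrite (_ : Ordinal lt_l = o1) //; exact: val_inj.
    - by rewrite mem_filter mem_enum.
  by split; apply: agree.
apply/(sat_imp hB) => /(sat_exists hB)[u' uu' /rP ru'].
by apply/rP; rewrite -!uu' // mem_filter.
Qed.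

Section Binary.
Variables (k : nat) (r : U -> U -> Prop).
Hypothesis kr : binary_set (h (v k)) r.

Lemma sat_var u : sat h v (tvar k) u <-> r (u o0) (u o1).
Proof. exact: kr. Qed.

Lemma sat_var02 u : sat h v (tvar02 k) u <-> r (u o0) (u o2).
Proof. by rewrite /tvar02 (sat_sub hB) // sat_var. Qed.

Lemma sat_var12 u : sat h v (tvar12 k) u <-> r (u o1) (u o2).
Proof. by rewrite /tvar12 !(sat_sub hB) // sat_var. Qed.

Lemma sat_pow m u : sat h v (tpow k m) u <-> rpow r m (u o0) (u o1).
Proof.
elim: m u => [|m IH] u /=; first exact: sat_d.
rewrite (sat_c hB); split=> -[w].
  by rewrite (sat_and hB) sat_var02 (sat_sub hB) // IH; exists w.
by exists w; rewrite (sat_and hB) sat_var02 (sat_sub hB) // IH.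
Qed.

End Binary.

Section Laws.
Variables (e f s : U -> U -> Prop).
Hypotheses (eP : binary_set (h (v 0)) e) (fP : binary_set (h (v 1)) f).
Hypothesis sP : binary_set (h (v 2)) s.

Let satE := (sat_imp hB, sat_and hB, sat_add hB, sat_opp hB, sat_d hB).

Lemma sat_pentagon :
  (forall u, foldr (fun t P => sat h v t u /\ P) True pentagon_terms) <->
  pentagonal e f.
Proof.
have fe u : sat h v (PC o2 (tand (tvar02 1) (tvar12 0))) u <->
    exists z, f (u o0) z /\ e (u o1) z.
  by rewrite (sat_c hB); split=> -[w];
     rewrite ?satE ?(sat_var02 fP) ?(sat_var12 eP) => ew; exists w;
     rewrite ?satE ?(sat_var02 fP) ?(sat_var12 eP).
split=> [H|[H1 H2 H3 H4 H5] u] /=; last first.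
  rewrite !satE fe (sat_var eP) (sat_var fP) (sat_var02 eP) (sat_var02 fP).
  rewrite (sat_var12 eP) (sat_var12 fP).
  split; first by case; apply: H1.
  split; first by case; apply: H2.
  split; first exact: H3.
  split; first exact: H4.
  by split; first exact: H5.
have {}H x y z : _ := H (triple x y z).
move: H; rewrite /= => H.
by split=> x y; [move=> z|move=> z|..]; have := H x y; 
  [move/(_ z)|move/(_ z)|move/(_ y)..];
  rewrite !satE fe (sat_var eP) (sat_var fP) (sat_var02 eP) (sat_var02 fP)
   (sat_var12 eP) (sat_var12 fP) /=; tauto.
Qed.

Lemma sat_rotation m :
  (forall u, foldr (fun t P => sat h v t u /\ P) True (rotation_terms m)) <->
  rotation m s.
Proof.
split=> [H|[H1 H2 H3] u] /=; last first.
  rewrite !satE (sat_var sP) (sat_var02 sP) (sat_pow sP).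
  split; first by case; apply: H1.
  split; first exact: H2.
  by split; first exact: H3.
have {}H x y z : _ := H (triple x y z).
by split=> x y; [move=> z|..]; have := H x y; 
  [move/(_ z)|move/(_ y)..];
  rewrite /= !satE (sat_var sP) (sat_var02 sP) (sat_pow sP) /=; tauto.
Qed.

Definition part (b : bool) := h (v (if b then 4 else 3)).
Definition swapped_part (b : bool) :=
  h (pol_p o0 o1 (v (if b then 4 else 3))).

Lemma sat_splitting :
  (forall b u, foldr (fun t P => sat h v t u /\ P) True (splitting_terms b)) <->
  splitting e s part swapped_part.
Proof.
have ss u : sat h v (PC o1 tS) u <-> exists y, s (u o0) y.
  by rewrite (sat_c hB); split=> -[w]; [move/(sat_var sP)|move=> sw];
    exists w => //; apply/(sat_var sP).
have se b u : sat h v (timp (tR b) tE) u <-> (part b u -> e (u o0) (u o1)).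
  by rewrite (sat_imp hB) (sat_var eP).
split=> [H|[H1 H2 H3 H4 H5] b u] /=; last first.
  split; first by apply/se; exact: H1.
  split; first by apply/(sat_imp hB) => /H2 nR; apply/(sat_opp hB).
  split; first by apply/(sat_imp hB) => /H3 fR; apply/(sat_c hB).
  split; first by apply/(sat_imp hB) => bR; apply/ss; exact: (H4 b u bR).
  by split=> //; apply/(sat_imp hB); exact: H5.
split=> b u; have [/se H1 [/(sat_imp hB) H2 [/(sat_imp hB) H3
    [/(sat_imp hB) H4 [/(sat_imp hB) H5 _]]]]] := H b u.
- exact: H1.
- by move/H2/(sat_opp hB).
- by move/H3/(sat_c hB).
- by move/H4/ss.
- exact: H5.
Qed.

End Laws.

Lemma sat_hypothesis m :
  (forall u, sat h v (hypothesis m) u) <->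
  exists e f s, [/\ binary_set (h (v 0)) e, binary_set (h (v 1)) f,
                    binary_set (h (v 2)) s &
                [/\ pentagonal e f, rotation m s &
                    splitting e s part swapped_part]].
Proof.
have catE u L1 L2 : foldr (fun t P => sat h v t u /\ P) True (L1 ++ L2) <->
    foldr (fun t P => sat h v t u /\ P) True L1 /\
    foldr (fun t P => sat h v t u /\ P) True L2.
  elim: L1 => [|t L1 IH] /=; first by split=> [|[]].
  by rewrite IH; split=> [[? []]|[[]]].
split=> [H|[e [f [s [eP fP sP [ef rs sp]]]]] u]; last first.
  apply/(sat_all hB); rewrite !catE; split; last split; last split; last split.
  - have tb k r : binary_set (h (v k)) r -> sat h v (tbinary k) u.
      by move=> kr; apply: (proj2 (sat_binary k)); exists r.
    by split; [exact: tb eP|split; [exact: tb fP|split; [exact: tb sP|]]].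
  - exact: (proj2 (sat_pentagon eP fP)).
  - exact: (proj2 (sat_rotation sP m)).
  - exact: (proj2 (sat_splitting eP sP)).
  - exact: (proj2 (sat_splitting eP sP)).
have {}H u := proj1 (sat_all hB v _ _ _) (H u).
have Hb u := proj1 (catE _ _ _) (H u).
have [|e eP] := proj1 (sat_binary 0); first by move=> u; case: (Hb u) => -[].
have [|f fP] := proj1 (sat_binary 1).
  by move=> u; case: (Hb u) => -[_ []].
have [|s sP] := proj1 (sat_binary 2).
  by move=> u; case: (Hb u) => -[_ [_ []]].
exists e, f, s; split=> //; split.
- by apply/(sat_pentagon eP fP) => u; have [_ /catE[]] := Hb u.
- by apply/(sat_rotation sP m) => u; have [_ /catE[_ /catE[]]] := Hb u.
- apply/(sat_splitting eP sP) => -[] u;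
    by have [_ /catE[_ /catE[_ /catE[]]]] := Hb u.
Qed.

End Semantics.

Lemma separating_eqP (B : pol_algebra N) U (h : B -> set ('I_N -> U)) m :
  realizes h ->
  pol_true B (separating_eq m) <->
  forall v e f s, binary_set (h (v 0)) e -> binary_set (h (v 1)) f ->
    binary_set (h (v 2)) s -> pentagonal e f -> rotation m s ->
    splitting e s (part h v) (swapped_part h v) ->
    forall u, ~ part h v false u.
Proof.
move=> hB; split=> [Bm v e f s eP fP sP ef rs sp u|Bm v].
  have vm : forall u, sat h v (hypothesis m) u.
    by apply/(sat_hypothesis hB); exists e, f, s.
  have : sat h v (separating_eq m).1 u.
    by rewrite /sat Bm; apply/(sat_d hB).
  rewrite (sat_add hB) (sat_opp hB) => -[|//].
  by case/(sat_exists hB) => u' _ /(sat_opp hB); case; exact: vm.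
apply: (real_inj hB); apply: funext => u; apply: propext; split=> _.
  exact/(sat_d hB).
apply/(sat_add hB).
have [/(sat_hypothesis hB)|nH] := pselect (forall u, sat h v (hypothesis m) u).
  case=> e [f [s [eP fP sP [ef rs sp]]]]; right; apply/(sat_opp hB).
  exact: Bm eP fP sP ef rs sp u.
left; have /existsNP[u' nu'] := nH.
apply/(sat_exists hB); exists u'; last exact/(sat_opp hB).
by move=> k; rewrite mem_enum.
Qed.

End Hypotheses.

(** Each vertex has at most two neighbours, hence exactly one in each matching.
    Follow edges alternately in the two matchings: x0, x1, x2, x3, x4. Then x0
    and x4 are both joined to x2 by a diagonal, so they are equal, a square, or
    joined by an edge. The edge from x4 to x0 lies in one of the two matchings,
    and either possibility gives some vertex two edges of one matching. *)
Lemma pentagonal_no_matchings U (e f : U -> U -> Prop)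
    (r : bool -> U -> U -> Prop) :
  pentagonal e f -> (forall b x y, r b x y -> e x y) ->
  (forall b x y, r b x y -> ~ r (~~ b) x y) ->
  (forall b x y, r b x y -> r b y x) ->
  (forall b x y, r b x y -> exists x', r (~~ b) x' y) ->
  forall b x y, ~ r b x y.
Proof.
move=> ef re rdisj rsym rflip.
have two x y1 y2 y3 :
    e x y1 -> e x y2 -> e x y3 -> y1 <> y2 -> y1 <> y3 -> y2 = y3.
  move=> e1 e2 e3 n12 n13.
  case: (fork_e ef e1 e2) => // f12; case: (fork_e ef e1 e3) => // f13.
  case: (fork_e ef e2 e3) => // f23.
  by case: (fork_f ef f12 f13) => // /(disj_ef ef).
have rother b x y : r b x y -> exists z, r (~~ b) x z.
  by move=> /rsym/rflip[z /rsym]; exists z.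
have rne b x y z : r b x y -> r (~~ b) x z -> y <> z.
  by move=> xy xz yz; case: (rdisj _ _ _ xy); rewrite yz.
have rfun b x y z : r b x y -> r b x z -> y = z.
  move=> xy xz; have [w xw] := rother _ _ _ xy.
  apply: (two x w) (re _ _ _ xw) (re _ _ _ xy) (re _ _ _ xz) _ _; apply: nesym.
    exact: rne xy xw.
  exact: rne xz xw.
move=> b x0 x1 r01; have r10 := rsym _ _ _ r01.
have [x2 r12] := rother _ _ _ r10; have r21 := rsym _ _ _ r12.
have [x3 r23] := rother _ _ _ r21; have r32 := rsym _ _ _ r23.
have [x4 r34] := rother _ _ _ r32; have r43 := rsym _ _ _ r34.
rewrite negbK in r23 r32 r34 r43.
have n20 : x2 <> x0 by exact/nesym/(rne _ _ _ _ r10 r12).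
have n24 : x2 <> x4 by exact: rne r32 r34.
have n13 : x1 <> x3.
  by move=> e13; apply: (rdisj _ _ _ r23); rewrite -e13.
have f20 : f x2 x0 by case: (fork_e ef (re _ _ _ r12) (re _ _ _ r10)).
have f02 : f x0 x2.
  by case: (fork_e ef (re _ _ _ r10) (re _ _ _ r12)) => // /nesym.
have f24 : f x2 x4 by case: (fork_e ef (re _ _ _ r32) (re _ _ _ r34)).
case: (fork_f ef f20 f24) => [e04|e04].
  (* A square: the third point given by f_fe is a neighbour of x2, hence x1 or
     x3, but these are joined to x0 by an edge and not by a diagonal. *)
  have [w [f0w e2w]] := f_fe ef f02.
  have [w1|n1w] := pselect (x1 = w).
    by apply: (disj_ef ef (re _ _ _ r01)); rewrite w1.
  have w3 := two _ _ _ _ (re _ _ _ r21) (re _ _ _ r23) e2w n13 n1w.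
  by apply: (disj_ef ef (re _ _ _ r43)); rewrite w3 -e04.
have [y r0y] := rother _ _ _ r01; have n1y : x1 <> y by exact: rne r01 r0y.
have [e14|n14] := pselect (x1 = x4).
  have := rfun _ _ _ _ r12 (_ : r (~~ b) x1 x3); rewrite e14 => /(_ r43) e23.
  by apply: (irr_e ef (re _ _ _ r23)).
have ey4 := two _ _ _ _ (re _ _ _ r01) (re _ _ _ r0y) e04 n1y n14.
rewrite ey4 in r0y.
have e03 := rfun _ _ _ _ (rsym _ _ _ r0y) r43.
have e12 : x1 = x2 by apply: rfun r01 _; rewrite e03.
exact: (irr_e ef (re _ _ _ r12)).
Qed.

Lemma no_symmetric_splitting n U (e f s : U -> U -> Prop)
    (R Q : bool -> set ('I_n.+3 -> U)) :
  pentagonal e f -> splitting e s R Q ->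
  (forall b u, R b u -> Q b (u \o tperm (o0 n) (o1 n))) -> forall b u, ~ R b u.
Proof.
move=> ef [Re Rdisj Rflip _ Rswap] RQ b u.
pose pt x y := upd (upd u (o0 n) x) (o1 n) y.
have updE x y x' : upd (pt x y) (o0 n) x' = pt x' y.
  apply: funext => k; rewrite /pt /upd.
  by case: (eqVneq k (o0 n)) => // ->.
have swapE x y : pt x y \o tperm (o0 n) (o1 n) = pt y x.
  apply: funext => k; rewrite /pt /upd /=.
  by case: tpermP => [->|->|/eqP/negPf-> /eqP/negPf->].
have ptE : pt (u (o0 n)) (u (o1 n)) = u.
  apply: funext => k; rewrite /pt /upd.
  by case: (eqVneq k (o1 n)) => [->|_] //; case: (eqVneq k (o0 n)) => [->|].
rewrite -ptE.
apply: (pentagonal_no_matchings ef (r := fun b x y => R b (pt x y))).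
- by move=> c x y /Re.
- by move=> c x y; apply: Rdisj.
- by move=> c x y /RQ; rewrite swapE; apply: Rswap.
- by move=> c x y /Rflip[x']; rewrite updE; exists x'.
Qed.

Lemma Pse_separating n m (B : pol_algebra n.+3) :
  Pse B -> pol_true B (separating_eq n m).
Proof.
case=> U [A [hA ->]].
apply/(separating_eqP _ (realizes_expansion hA
  (fun i j x => @pol_p _ (pol_set_algebra hA) i j x))).
move=> v e f s eP fP sP ef rs sp u; apply: (no_symmetric_splitting ef sp) => b w.
rewrite /swapped_part /= transpositionE /=.
suff -> : (w \o tperm (o0 n) (o1 n)) \o tperm (o0 n) (o1 n) = w by [].
by apply: funext => k /=; rewrite tpermK.
Qed.

(** * The pentagon algebras *)

Section PentagonAlgebra.
Local Open Scope ring_scope.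
Import GRing.Theory.
Variables (n m : nat).
Notation N := n.+3.
Notation o0 := (o0 n).
Notation o1 := (o1 n).
Notation o2 := (o2 n).

Definition point : Type := ('Z_m * 'Z_5 + 'I_N * bool)%type.
(** A motion (i, (c, r), b) adds [i] to the number of the pentagon, maps the
    vertex [v] to [c + v], or to [c - v] if [r] holds, and exchanges the
    elements of the [k]-th two-element set if [b k] holds. *)
Definition motion : Type := ('Z_m * ('Z_5 * bool) * ('I_N -> bool))%type.

Definition sg (b : bool) : 'Z_5 := if b then -1 else 1.

Lemma sgM b c : sg (b (+) c) = sg b * sg c.
Proof. by case: b c => -[]; rewrite /sg /= ?mulr1 ?mul1r // mulrN1 opprK. Qed.

Lemma sgK b x : sg b * (sg b * x) = x.
Proof. by rewrite mulrA -sgM addbb mul1r. Qed.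

Definition motion_act (g : motion) (x : point) : point :=
  match x with
  | inl (i, v) => inl (i + g.1.1, sg g.1.2.2 * v + g.1.2.1)
  | inr (k, b) => inr (k, b (+) g.2 k)
  end.

Definition parity (b : 'I_N -> bool) : bool :=
  \big[addb/false]_(k : 'I_N | (1 < k)%N) b k.

Lemma parityD b c : parity (fun k => b k (+) c k) = parity b (+) parity c.
Proof. exact: big_split. Qed.

Lemma parity1 (k : 'I_N) : (1 < k)%N -> parity (fun l => l == k) = true.
Proof.
move=> k1; rewrite /parity (bigD1 k) //= eqxx big1 // => l /andP[_ /negPf //].
Qed.

Lemma parity0 : parity (fun=> false) = false.
Proof. exact: big1. Qed.

Definition motion_mul (g h : motion) : motion :=
  ((h.1.1 + g.1.1, (sg g.1.2.2 * h.1.2.1 + g.1.2.1, g.1.2.2 (+) h.1.2.2)),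
   fun k => g.2 k (+) h.2 k).

Definition motion_inv (g : motion) : motion :=
  ((- g.1.1, (- (sg g.1.2.2 * g.1.2.1), g.1.2.2)), g.2).

Definition motion_action : signed_action point.
Proof.
exists motion motion_act motion_mul motion_inv (fun g => g.1.2.2 (+) parity g.2).
- move=> [[a [c r]] b] [[a' [c' r']] b'] [[i v]|[k x]] /=.
    by rewrite addrA sgM mulrDr mulrA addrA.
  by rewrite -addbA (addbC (b k)).
- move=> [[a [c r]] b] [[i v]|[k x]] /=; last by rewrite addbK.
  by rewrite addrK mulrDr sgK addrK.
- move=> [[a [c r]] b] [[i v]|[k x]] /=; last by rewrite addbK.
  by rewrite subrK mulrDr mulrN !sgK subrK.
- move=> [[a [c r]] b] [[a' [c' r']] b'] /=; rewrite parityD.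
  by case: r r' (parity b) (parity b') => -[] [] [].
- by [].
Defined.

Definition flag i v e (b : 'I_N -> bool) : 'I_N -> point := fun k =>
  if k == o0 then inl (i, v) else if k == o1 then inl (i, v + sg e)
  else inr (k, b k).

Definition flags : set ('I_N -> point) :=
  [set t | exists (s : 'S_N) i v e b, t = flag i v e b \o s].

(** Any odd central involution would do for the twist; this one exists because
    the dimension is at least 3. *)
Definition flip_second : motion_action := ((0, (0, false)), fun k => k == o2).

Lemma tact_flag a c r b i v e b' :
  tact (((a, (c, r)), b) : motion_action) (flag i v e b') =
  flag (i + a) (sg r * v + c) (r (+) e) (fun k => b' k (+) b k).
Proof.
apply: funext => k; rewrite /tact /flag /=; case: ifP => // _; case: ifP => // _ /=.
by rewrite mulrDr sgM addrAC.
Qed.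

Lemma flags_flag i v e b : flags (flag i v e b).
Proof.
by exists 1%g, i, v, e, b; apply: funext => k /=; rewrite perm1.
Qed.

Lemma sg_neq0 e : sg e != 0.
Proof. by case: e. Qed.

Lemma flag_inj i v e b : injective (flag i v e b).
Proof.
move=> k l; rewrite /flag; case: (eqVneq k o0) => [->|_]; last first.
  case: (eqVneq k o1) => [->|_]; last first.
    by case: ifP => // _; case: ifP => // _ [].
  case: ifP => [_|_]; last by case: ifP => [/eqP->|].
  by case=> /eqP; rewrite -subr_eq0 addrC addrA addNr add0r (negPf (sg_neq0 e)).
case: ifP => [/eqP->//|_]; case: ifP => // _ [] /eqP.
by rewrite eq_sym -subr_eq0 addrC addrA addNr add0r (negPf (sg_neq0 e)).
Qed.

(** For [twist_flip]: the reflection of the pentagon through one end of an edge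
    fixes that end and moves the other one; the remaining coordinates of a flag
    lie in two-element sets of their own, each of which can be exchanged
    separately. *)
Lemma twisting_flags : twisting flags flip_second.
Proof.
have tactP (g : motion_action) t : flags t -> flags (tact g t).
  case: g => [[a [c r]] d] [s [i [v [e [b ->]]]]].
  exists s, (i + a), (sg r * v + c), (r (+) e), (fun k => b k (+) d k).
  by rewrite -tact_flag.
split.
- move=> g t; split=> [/(tactP (ginv g))|]; last exact: tactP.
  suff -> : tact (ginv g) (tact g t) = t by [].
  by apply: funext => k; rewrite /tact actK.
- move=> s t [s' [i [v [e [b ->]]]]]; exists (s * s')%g, i, v, e, b.
  by apply: funext => k /=; rewrite permM.
- by move=> t [s [i [v [e [b ->]]]]]; apply: inj_comp (@flag_inj _ _ _ _) perm_inj.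
- move=> t k [s [i [v [e [b ->]]]]].
  suff [g [sg_ gP]] : exists g : motion_action, sign g /\
      forall l, l != s k -> act g (flag i v e b l) = flag i v e b l.
    by exists g; split=> // l lk /=; apply: gP; rewrite (inj_eq perm_inj).
  pose reflection w : motion_action := ((0, (w *+ 2, true)), fun=> false).
  have reflE w x y : act (reflection w) (inl (x, y)) = inl (x, w *+ 2 - y).
    by rewrite /= addr0 mulN1r addrC.
  case: (eqVneq (s k) o0) => [->|k0].
    exists (reflection (v + sg e)); split; first by rewrite /= parity0.
    move=> l /negPf l0; rewrite /flag l0; case: ifP => _.
      by rewrite reflE mulr2n addrK.
    by rewrite /= addbF.
  case: (eqVneq (s k) o1) => [->|k1].
    exists (reflection v); split; first by rewrite /= parity0.
    move=> l /negPf l1; rewrite /flag l1; case: ifP => _.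
      by rewrite reflE mulr2n addrK.
    by rewrite /= addbF.
  exists ((0, (0, false)), fun l => l == s k); split.
    rewrite /= parity1 //; move: k0 k1; rewrite -!val_eqE /=.
    by case: (nat_of_ord _) => [|[]].
  move=> l /negPf lk; rewrite /flag; case: ifP => _.
    by rewrite /= !addr0 mul1r.
  by case: ifP => _ /=; rewrite ?addr0 ?mul1r // lk addbF.
- move=> [[a [c r]] b] [[i v]|[k x]] /=; first by rewrite !addr0 !mul1r.
  by rewrite addbAC.
- move=> [[i v]|[k x]] /=; first by rewrite !addr0 !mul1r.
  by rewrite addbK.
Qed.

Definition flag_admissible : set (set ('I_N -> point)) :=
  [set X | admissible motion_action flags X].

Lemma flag_admissible_closed : cyl_closed flag_admissible.
Proof.
split.
- by move=> X Y; apply: admissibleU.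
- by move=> X; apply: (admissibleN twisting_flags).
- by move=> i X; apply: (admissible_cylindrification twisting_flags).
- by move=> i j; apply: admissible_diagonal.
Qed.

Definition pentagon_algebra : pol_algebra N :=
  expansion flag_admissible_closed (fun i j x => exist flag_admissible
    (twisted_transposition flags flip_second i j (sval x))
    (admissible_twisted twisting_flags (svalP x))).

Lemma pentagon_algebra_RCPEA : RCPEA pentagon_algebra.
Proof.
split.
  move=> e eE; apply: eE.
  by exists point, flag_admissible, flag_admissible_closed.
exact: (twisted_polyadic_axioms twisting_flags).
Qed.

(** The edges of the pentagons for [c = 1], the diagonals for [c = 2]. *)
Definition neighbour (c : 'Z_5) (x y : point) : Prop :=
  exists i v e, x = inl (i, v) /\ y = inl (i, v + sg e * c).

Definition shift (x y : point) : Prop :=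
  exists i v, x = inl (i, v) /\ y = inl (i + 1, v).

(** The orbits of the even motions on the flags: reversing the edge of a flag or
    exchanging one of the two-element sets with index at least 2 leads from one
    to the other. *)
Definition flag_part (p : bool) : set ('I_N -> point) :=
  [set t | exists i v e b, t = flag i v e b /\ e (+) parity b = p].

Lemma invariant_admissible (r : point -> point -> Prop) :
  (forall (g : motion_action) x y, r x y -> r (act g x) (act g y)) ->
  flag_admissible [set t | r (t o0) (t o1)].
Proof. by move=> rG g t rt _; apply: rG. Qed.

Lemma neighbour_invariant c (g : motion_action) x y :
  neighbour c x y -> neighbour c (act g x) (act g y).
Proof.
case: g => [[a [d r]] b] [i [v [e [-> ->]]]].
exists (i + a), (sg r * v + d), (r (+) e); split=> //=.
by rewrite sgM; congr (inl (_, _)); ring.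
Qed.

Lemma shift_invariant (g : motion_action) x y :
  shift x y -> shift (act g x) (act g y).
Proof.
case: g => [[a [d r]] b] [i [v [-> ->]]].
by exists (i + a), (sg r * v + d); rewrite /= addrAC.
Qed.

Lemma flag_part_admissible p : flag_admissible (flag_part p).
Proof.
move=> [[a [c r]] d] _ [i [v [e [b [-> bp]]]]].
move=> /(_ (flags_flag _ _ _ _)) /= sg0; rewrite tact_flag.
exists (i + a), (sg r * v + c), (r (+) e), (fun k => b k (+) d k); split=> //.
by rewrite parityD; case: r e (parity b) (parity d) bp sg0 => -[] [] [].
Qed.

Lemma inl_inj i v j w : inl (i, v) = inl (j, w) :> point -> i = j /\ v = w.
Proof. by case=> -> ->. Qed.

Lemma addr_neq v (w : 'Z_5) : w != 0 -> v <> v + w.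
Proof.
by move=> w0 /eqP; rewrite -{1}[v]addr0 (inj_eq (addrI _)) eq_sym (negPf w0).
Qed.

Lemma pentagonal_neighbours :
  pentagonal (neighbour 1) (neighbour 2%:R).
Proof.
have ne0 (c : 'Z_5) e : c != 0 -> sg e * c != 0.
  by case: e => c0; rewrite /sg ?mul1r // mulN1r oppr_eq0.
split.
- move=> x y z [i [v [e [-> ->]]]] [_ [_ [e' [[<- <-] ->]]]].
  have [->|ee'] := eqVneq e e'; first by left.
  right; exists i, (v + sg e * 1), e'; split=> //; congr (inl (_, _)).
  by case: e e' ee' => -[] //= _; rewrite /sg; ring.
- move=> x y z [i [v [e [-> ->]]]] [_ [_ [e' [[<- <-] ->]]]].
  have [->|ee'] := eqVneq e e'; first by left.
  right; exists i, (v + sg e * 2%:R), e; split=> //; congr (inl (_, _)).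
  have five : 5%:R = 0 :> 'Z_5 by exact: val_inj.
  case: e e' ee' => -[] //= _; rewrite /sg; apply/eqP; rewrite -subr_eq0; apply/eqP.
    by transitivity (5%:R : 'Z_5) => //; ring.
  by transitivity (- 5%:R : 'Z_5); [ring|rewrite five oppr0].
- move=> x y [i [v [e [-> ->]]]] [_ [_ [e' [[<- <-] /inl_inj[_ /addrI]]]]].
  by case: e e' => -[].
- by move=> x y [i [v [e [-> ->]]]] /inl_inj[_]; apply/addr_neq/ne0.
- move=> x y [i [v [e [-> ->]]]].
  exists (inl (i, v + sg (~~ e) * 2%:R)); split; first by exists i, v, (~~ e).
  exists i, (v + sg e * 2%:R), e; split=> //; congr (inl (_, _)).
  have five : 5%:R = 0 :> 'Z_5 by exact: val_inj.
  case: e => /=; rewrite /sg; apply/eqP; rewrite -subr_eq0; apply/eqP.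
    by transitivity (5%:R : 'Z_5) => //; ring.
  by transitivity (- 5%:R : 'Z_5); [ring|rewrite five oppr0].
Qed.

Hypothesis m_gt1 : (1 < m)%N.

Lemma rpow_shift k i v y : rpow shift k (inl (i, v)) y <-> y = inl (i + k%:R, v).
Proof.
elim: k i y => [|k IH] i y /=; first by rewrite addr0; split.
have iE : i + 1 + k%:R = i + k.+1%:R by rewrite -natr1 -addrA (addrC 1).
split=> [[z [[j [w [/inl_inj[<- <-] zE]]]]]|->].
  by rewrite zE => /IH->; rewrite iE.
exists (inl (i + 1, v)); split; first by exists i, v.
by apply/IH; rewrite iE.
Qed.

Lemma rotation_shift : rotation m shift.
Proof.
split.
- by move=> x y z [i [v [-> ->]]] [_ [_ [[<- <-] ->]]].
- move=> x y [i [v [-> ->]]] /inl_inj[/eqP].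
  by rewrite eq_sym -subr_eq0 addrC addrA addNr add0r oner_eq0.
- move=> [[i v]|[k b]] y.
    by move/rpow_shift->; rewrite pchar_Zp // addr0.
  suff nr j : (0 < j)%N -> ~ rpow shift j (inr (k, b)) y by move/(nr _ (ltnW m_gt1)).
  by case: j => // j _ [z [[i [v [E _]]] _]].
Qed.

Lemma parity_flag_unique i v e b i' v' e' b' :
  flag i v e b = flag i' v' e' b' -> e = e' /\ parity b = parity b'.
Proof.
move=> E; split.
  have /inl_inj[_ vv'] := congr1 (fun t => t o0) E.
  have /inl_inj[_] := congr1 (fun t => t o1) E; rewrite vv' => /addrI.
  by case: e e' {E} => -[].
apply: eq_bigr => k k1; have := congr1 (fun t => t k) E.
have [k0 k1'] : k != o0 /\ k != o1.
  by move: k1; rewrite -!val_eqE /=; case: (nat_of_ord k) => [|[]].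
by rewrite /flag (negPf k0) (negPf k1') => -[].
Qed.

(** Interchanging the coordinates 0 and 1 reverses the edge, which changes the
    half; the twist changes it back. *)
Lemma swapped_flag_part p t :
  flag_part p (twisted_swap flags flip_second o0 o1 t) -> flag_part p t.
Proof.
move=> [i [v [e [b [tE bp]]]]].
rewrite -[t](twisted_swapK twisting_flags o0 o1) tE.
rewrite /twisted_swap (introT (asboolP _) (flags_flag i v e b)) /=.
have -> : flag i v e b \o tperm o0 o1 = flag i (v + sg e) (~~ e) b.
  apply: funext => k; rewrite /flag /=.
  case: tpermP => [->|->|/eqP/negPf-> /eqP/negPf->] //=.
  by congr (inl (_, _)); case: (e); rewrite /sg /= ?subrK ?addrK.
rewrite tact_flag; do 4 eexists; split; first by [].
by rewrite parityD parity1 // -bp; case: (e); case: (parity b).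
Qed.

Lemma flag_part_splitting :
  splitting (neighbour 1) shift flag_part
    (fun p => twisted_transposition flags flip_second o0 o1 (flag_part p)).
Proof.
split.
- by move=> p _ [i [v [e [b [-> _]]]]]; exists i, v, e; rewrite mulr1.
- move=> p _ [i [v [e [b [-> <-]]]]] [i' [v' [e' [b' [/parity_flag_unique[-> ->]]]]]].
  by case: (e' (+) _).
- move=> p _ [i [v [e [b [-> <-]]]]]; exists (inl (i, v + sg e *+ 2)).
  exists i, (v + sg e *+ 2), (~~ e), b; split; last by case: (e); case: (parity b).
  apply: funext => k; rewrite /upd /flag.
  case: (eqVneq k o0) => // _; case: ifP => // _.
  congr (inl (_, _)); rewrite mulr2n addrA.
  by case: (e); rewrite /sg /= ?subrK ?addrK.
- by move=> p _ [i [v [e [b [-> _]]]]]; exists (inl (i + 1, v)), i, v.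
- by move=> p t; apply: swapped_flag_part.
Qed.

Definition pentagon_valuation (k : nat) : pentagon_algebra :=
  match k with
  | 0 => exist flag_admissible _
      (@invariant_admissible (neighbour 1) (@neighbour_invariant 1))
  | 1 => exist flag_admissible _
      (@invariant_admissible (neighbour 2%:R) (@neighbour_invariant 2%:R))
  | 2 => exist flag_admissible _
      (@invariant_admissible shift shift_invariant)
  | 3 => exist flag_admissible _ (@flag_part_admissible false)
  | _ => exist flag_admissible _ (@flag_part_admissible true)
  end.

Lemma pentagon_algebra_fails : ~ pol_true pentagon_algebra (separating_eq n m).
Proof.
move/(separating_eqP m (realizes_expansion flag_admissible_closed _)).
move=> /(_ pentagon_valuation (neighbour 1) (neighbour 2%:R) shift).
have partE :
    part (fun x : pentagon_algebra => sval x) pentagon_valuation = flag_part.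
  by apply: funext => -[].
have swapE :
    swapped_part (fun x : pentagon_algebra => sval x) pentagon_valuation =
    fun p => twisted_transposition flags flip_second o0 o1 (flag_part p).
  by apply: funext => -[].
move=> H; apply: (H _ _ _ pentagonal_neighbours rotation_shift _
  (flag 0 0 false (fun=> false))) => //.
  rewrite [part _ _]partE [swapped_part _ _]swapE.
  exact: flag_part_splitting.
by rewrite [part _ _]partE; exists 0, 0, false, (fun=> false); rewrite parity0.
Qed.

(** The inverse of 2 modulo 5 is 3. *)
Lemma double_double (x : 'Z_5) : x = x *+ 2 *+ 3.
Proof.
rewrite -mulrnA -[(2 * 3)%N]/(5.+1) mulrSr -mulr_natr.
by rewrite (_ : 5%:R = 0) ?mulr0 ?add0r //; exact: val_inj.
Qed.

(** An invariant function maps [x] to a point fixed by all motions that fix [x].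
    The only such points are, for a vertex, the corresponding vertices of all
    the pentagons, and for a point of a two-element set, the two elements of
    that set. So [s], having no fixed points, acts there as a nontrivial power of
    the shift or as an exchange, and its [k]-th power is not the identity when [k] is odd and prime to [m]. *)
Lemma no_invariant_rotation k s : coprime m k -> odd k -> rotation k s ->
  (forall (g : motion_action) x y, s x y -> s (act g x) (act g y)) ->
  forall x y, ~ s x y.
Proof.
move=> mk oddk rs sG.
have fixed (g : motion_action) x y : s x y -> act g x = x -> act g y = y.
  by move=> sxy gx; have := sG g _ _ sxy; rewrite gx => /(fun_s rs sxy).
pose flip l : motion_action := ((0, (0, false)), fun j => j == l).
have flipl l i v : act (flip l) (inl (i, v)) = inl (i, v).
  by rewrite /= !addr0 mul1r.
have flipr l j b : act (flip l) (inr (j, b)) = inr (j, b (+) (j == l)) by [].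
move=> [[i v]|[l b]] [[j w]|[l' b']] sxy.
- pose refl : motion_action := ((0, (v *+ 2, true)), fun=> false).
  have reflE a x : act refl (inl (a, x)) = inl (a, v *+ 2 - x).
    by rewrite /= addr0 mulN1r addrC.
  (* The reflection through v fixes x, so it fixes y: the same vertex of some
     other pentagon. *)
  have vw : v = w.
    have : act refl (inl (j, w)) = inl (j, w).
      by apply: (fixed _ _ _ sxy); rewrite reflE mulr2n addrK.
    rewrite reflE => /inl_inj[_ vw]; rewrite (double_double v) (double_double w).
    by rewrite -{1}[v *+ 2](subrK w) vw.
  rewrite -{}vw in sxy; set c := j - i.
  have sc a : s (inl (a, v)) (inl (a + c, v)).
    have := sG ((a - i, (0, false)), fun=> false) _ _ sxy; rewrite /= !addr0 !mul1r.
    by rewrite addrCA subrr addr0 addrCA.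
  have pc q a : rpow s q (inl (a, v)) (inl (a + c *+ q, v)).
    elim: q a => [|q IH] a /=; first by rewrite addr0.
    exists (inl (a + c, v)); split; first exact: sc.
    by rewrite mulrS (addrA a c); exact: IH.
  have /inl_inj[/eqP] := pow_s rs (pc k i).
  rewrite eq_sym -subr_eq0 addrC addrA addNr add0r -mulr_natr => /eqP ck _.
  have uk : k%:R \is a @GRing.unit 'Z_m by rewrite unitZpE.
  have c0 : c = 0 by rewrite -[c](mulrK uk) ck mul0r.
  by apply: (irr_s rs (sc i)); rewrite c0 addr0.
- (* Exchanging the set of y fixes the vertex x but moves y. *)
  have := fixed (flip l') _ _ sxy (flipl _ _ _); rewrite flipr eqxx addbT.
  by case; case: (b').
- (* The cyclic shift of the pentagons fixes x but moves the vertex y. *)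
  have := fixed ((1, (0, false)), fun=> false) _ _ sxy.
  rewrite /= addbF => /(_ erefl).
  move/inl_inj=> [/eqP]; rewrite -subr_eq0 addrAC subrr add0r oner_eq0 //.
- have [ll'|nll'] := eqVneq l l'; last first.
    have := fixed (flip l') _ _ sxy; rewrite !flipr (negPf nll') addbF => /(_ erefl).
    by rewrite eqxx addbT => -[]; case: (b').
  rewrite -{l'}ll' in sxy *.
  have bb' : b' = ~~ b.
    by have := irr_s rs sxy; case: (b) (b') => -[] // [].
  rewrite {}bb' in sxy.
  have sb a : s (inr (l, a)) (inr (l, ~~ a)).
    have [<-//|ab] := eqVneq b a.
    have := sG (flip l) _ _ sxy; rewrite !flipr eqxx !addbT.
    by case: (a) (b) ab => -[].
  have pb q a : rpow s q (inr (l, a)) (inr (l, a (+) odd q)).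
    elim: q a => [|q IH] a /=; first by rewrite addbF.
    exists (inr (l, ~~ a)); split; first exact: sb.
    by rewrite addbN -addNb.
  have := pow_s rs (pb k b); rewrite oddk addbT => -[].
  by case: (b).
Qed.

(** An element of the algebra that is a binary relation is invariant under all
    motions, even or odd: whether it holds between two points can be tested on a
    tuple with a repeated entry, which is not a flag. *)
Lemma pentagon_algebra_satisfies k : coprime m k -> odd k ->
  pol_true pentagon_algebra (separating_eq n k).
Proof.
move=> mk oddk.
apply/(separating_eqP k (realizes_expansion flag_admissible_closed _)).
move=> v e f s eP fP sP ef rs sp u /(split_s sp)[y].
apply: (no_invariant_rotation mk oddk rs) => g x1 x2 sx.
pose t := triple x1 x2 x1 : 'I_N -> point.
have nT : ~ flags t by move/(twist_inj twisting_flags)/(_ o0 o2 erefl).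
have := svalP (v 2) g t; rewrite !sP; apply=> //.
Qed.

End PentagonAlgebra.

(** * One variety for every set of odd primes *)

Fixpoint odd_prime (k : nat) : nat :=
  s2val (prime_above (if k is k'.+1 then odd_prime k' else 2)).

Lemma odd_prime_prime k : prime (odd_prime k).
Proof. by case: k => [|k] /=; case: prime_above. Qed.

Lemma odd_prime_lt k : odd_prime k < odd_prime k.+1.
Proof. by rewrite /=; case: (prime_above (odd_prime k)). Qed.

Lemma odd_prime_inj : injective odd_prime.
Proof.
apply/incn_inj/leq_mono/(homo_ltn (r := fun p q => p < q) _ odd_prime_lt).
by move=> q p r; exact: ltn_trans.
Qed.

Lemma odd_prime_odd k : odd (odd_prime k).
Proof.
suff p2 : 2 < odd_prime k.
  by have [p_odd|//] := even_prime (odd_prime_prime k); rewrite p_odd in p2.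
elim: k => [|k IH] /=; first by case: prime_above.
by apply: ltn_trans IH _; exact: odd_prime_lt.
Qed.

Lemma odd_prime_coprime j k : j != k -> coprime (odd_prime j) (odd_prime k).
Proof.
by move=> jk; rewrite prime_coprime ?odd_prime_prime // dvdn_prime2
  ?odd_prime_prime // (inj_eq odd_prime_inj).
Qed.

Definition generating_class n (S : set nat) (C : pol_algebra n.+3) : Prop :=
  Pse C \/ exists2 k, S k & C = pentagon_algebra n (odd_prime k).

Theorem theorem4 (n : nat) (hn : 3 <= n) :
  continuum_many (fun V : pol_algebra n -> Prop =>
    [/\ variety V,
        (forall B : pol_algebra n, RPEA B -> V B) &
        (forall B : pol_algebra n, V B -> RCPEA B)]).
Proof.
case: n hn => [|[|[|n]]] // _.
apply: (continuum_many_varieties (W := fun S => models (@generating_class n S))).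
- by move=> V [].
- move=> S; split.
  + by exists (fun e => forall C, generating_class S C -> pol_true C e).
  + by move=> B RB e Se; apply: RB => C PC; apply: Se; left.
  + move=> B; apply: models_RCPEA => C [|[k _ ->]]; first exact: Pse_RCPEA.
    exact: pentagon_algebra_RCPEA.
have sub S S' :
    models (@generating_class n S) = models (@generating_class n S') -> S `<=` S'.
  move=> SS' k Sk; apply: contrapT => nS'k.
  apply: (@pentagon_algebra_fails n (odd_prime k)).
    exact/prime_gt1/odd_prime_prime.
  have : models (@generating_class n S) (pentagon_algebra n (odd_prime k)).
    by move=> e eS; apply: eS; right; exists k.
  rewrite SS'; apply=> C [/Pse_separating|[j S'j ->]]; first exact.
  apply: pentagon_algebra_satisfies; last exact: odd_prime_odd.
    exact/prime_gt1/odd_prime_prime.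
  by apply: odd_prime_coprime; apply: contra_notN nS'k => /eqP<-.
by move=> S S' SS'; apply/seteqP; split; apply: sub.
Qed.
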